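(* Let $d$ be an odd integer, let $R$ be an evenly graded commutative ring in which $2$ is invertible, and let $A$ be an odd Moore algebra of degree $d$ over $R$ whose $A_\infty$-structure has the form $m=ad\tau-\tau^2\partial_\tau+w(t)\partial_\tau$, where $w(t)=\sum_{i\ge1}w_it^{2i}$ is nonzero. Let $w_k$ be the first nonzero coefficient of $w(t)$. Suppose that $w_k$ is not a zero divisor and that $R$ has no $k$-torsion. Then there is an isomorphism of $R$-modules $$HH^*(A)\cong R[[t]]/(\widetilde{w}'(t)),$$ where $\widetilde{w}(t):=w(\sqrt{t})=\sum_{i\ge1}w_it^{i}$ and $\widetilde w'(t)=\sum_{i\ge1}i\,w_it^{i-1}$.
   Context: Evenly graded means concentrated in even degrees. $R[[\tau,t]]$ denotes the graded $R$-algebra of formal power series in two non-commuting variables with $|\tau|=-1$, $|t|=-(d+2)$ (elements of $R$ are central), with its natural topology. All derivations are graded derivations, $\xi(ab)=\xi(a)b+(-1)^{|\xi||a|}a\xi(b)$; $A\,\partial_\tau+B\,\partial_t$ denotes the continuous derivation with $\tau\mapsto A$, $t\mapsto B$; $ad\tau(x)=[\tau,x]$ is the graded commutator. An odd Moore algebra of degree $d$ is a unital $A_\infty$-structure on the free graded $R$-module $\Sigma^{d+1}R\oplus R$ ($d$ odd); it is given by a continuous derivation of $R[[\tau,t]]$ of degree $-1$ of the form $m=v(t)\partial_t+w(t)\partial_\tau+ad\tau-\tau^2\partial_\tau$, where $v(t)=\sum_{i\ge1}v_it^{2i}$ and $w(t)=\sum_{i\ge1}w_it^{2i}$ have degrees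 $-(d+3)$ and $-2$ (the condition $m^2=0$ is automatic). Here $v=0$. The Hochschild cohomology $HH^*(A)$ of $A$ with coefficients in itself is the cohomology of the complex $C^*(A,A)$ of normalised derivations $\xi=A(t)\partial_\tau+B(t)\partial_t$, where $A(t),B(t)\in R[[t]]$ are power series with vanishing constant terms, with differential $d(\xi)=[\xi,m]=\xi m-(-1)^{|\xi|}m\xi$ (graded commutator, extended bilinearly to inhomogeneous $\xi$). *)

(* Defs.v *)
From HB Require Import structures.
From mathcomp Require Import all_boot all_order all_algebra generic_quotient ring_quotient zify ring.
From mathcomp Require Import boolp classical_sets functions.

Set Implicit Arguments.
Unset Strict Implicit.
Unset Printing Implicit Defensive.

Import GRing.Theory.
Local Open Scope ring_scope.

Section LmodQuotient.
Variables (R : pzRingType) (V : lmodType R) (S : {pred V}).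
Variable clS : submod_closed S.

Definition submod_pred of submod_closed S : {pred V} := S.
HB.instance Definition _ :=
  GRing.isSubmodClosed.Build R V (submod_pred clS) clS.

Definition lmod_quot := Quotient.quot (submod_pred clS).
HB.instance Definition _ := GRing.Zmodule.on lmod_quot.

Definition to_quot (x : V) : lmod_quot := (\pi_lmod_quot x)%qT.

Lemma to_quot_eq (x y : V) : to_quot x = to_quot y <-> x - y \in S.
Proof.
have -> : (x - y \in S) = (x == y %[mod Quotient.quot (submod_pred clS)])%qT.
  exact: (@Quotient.idealrBE V (submod_pred clS)).
by split=> [/eqP|/eqP].
Qed.

Lemma to_quotK (q : lmod_quot) : to_quot (repr q) = q.
Proof. exact: reprK. Qed.

Lemma to_quotD x y : to_quot (x + y) = to_quot x + to_quot y.
Proof. exact: (raddfD (\pi_(Quotient.quot (submod_pred clS)))%qT). Qed.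

Definition lmod_quot_scale (a : R) (q : lmod_quot) : lmod_quot :=
  to_quot (a *: (repr q : V)).

Lemma lmod_quot_scaleE a x : lmod_quot_scale a (to_quot x) = to_quot (a *: x).
Proof.
apply/to_quot_eq; rewrite -scalerBr -[a *: _]addr0.
by apply: clS.2; [apply/to_quot_eq; rewrite to_quotK | exact: clS.1].
Qed.

Fact lmod_quot_scaleA a b q :
  lmod_quot_scale a (lmod_quot_scale b q) = lmod_quot_scale (a * b) q.
Proof. by rewrite -[q]to_quotK !lmod_quot_scaleE scalerA. Qed.

Fact lmod_quot_scale1 : left_id 1 lmod_quot_scale.
Proof. by move=> q; rewrite -[q]to_quotK lmod_quot_scaleE scale1r. Qed.

Fact lmod_quot_scaleDr : right_distributive lmod_quot_scale +%R.
Proof.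
move=> a p q; rewrite -[p]to_quotK -[q]to_quotK -to_quotD !lmod_quot_scaleE.
by rewrite scalerDr to_quotD.
Qed.

Fact lmod_quot_scaleDl q :
  {morph lmod_quot_scale^~ q : a b / a + b >-> a + b}.
Proof.
by move=> a b; rewrite -[q]to_quotK !lmod_quot_scaleE scalerDl to_quotD.
Qed.

HB.instance Definition _ := GRing.Zmodule_isLmodule.Build R lmod_quot
  lmod_quot_scaleA lmod_quot_scale1 lmod_quot_scaleDr lmod_quot_scaleDl.

Fact to_quot_linear : linear to_quot.
Proof. by move=> a x y; rewrite to_quotD -lmod_quot_scaleE. Qed.
HB.instance Definition _ := GRing.isLinear.Build R V lmod_quot *:%R to_quot
  to_quot_linear.

End LmodQuotient.

Record evenly_graded (R : comNzRingType) (Rg : int -> R -> Prop) : Prop := {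
  grade0 : forall n, Rg n 0;
  gradeB : forall n x y, Rg n x -> Rg n y -> Rg n (x - y);
  grade1 : Rg 0 1;
  gradeM : forall m n x y, Rg m x -> Rg n y -> Rg (m + n) (x * y);
  grade_span : forall x : R, exists (s : seq int) (c : int -> R),
    (forall n, Rg n (c n)) /\ x = \sum_(n <- s) c n;
  grade_direct : forall (s : seq int) (c : int -> R), uniq s ->
    (forall n, Rg n (c n)) -> \sum_(n <- s) c n = 0 ->
    forall n, n \in s -> c n = 0;
  grade_even : forall n x, Rg n x -> odd `|n|%N -> x = 0
}.

Definition fps (R : Type) := nat -> R.

Section FPS.
Variable R : comNzRingType.
Implicit Types f g h : fps R.

HB.instance Definition _ := GRing.Lmodule.copy (fps R) (nat -> R^o).

Definition fps_one : fps R := fun n => (n == 0%N)%:R.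
Definition fps_mul f g : fps R :=
  fun n => \sum_(i < n.+1) f i * g (n - i)%N.

Let tr N f : {poly R} := \poly_(i < N) f i.

Let tr_mul N f g n : (n < N)%N -> fps_mul f g n = (tr N f * tr N g)`_n.
Proof.
move=> nN; rewrite coefM; apply: eq_bigr => i _; rewrite !coef_poly.
by rewrite !(leq_ltn_trans _ nN) ?leq_subr // -ltnS.
Qed.

Let tr_mul3 N f g (p : {poly R}) n : (n < N)%N ->
  (tr N (fps_mul f g) * p)`_n = (tr N f * tr N g * p)`_n.
Proof.
move=> nN; rewrite !coefM; apply: eq_bigr => i _; congr (_ * _).
have iN : (i < N)%N by rewrite (leq_ltn_trans _ nN) // -ltnS.
by rewrite coef_poly iN (tr_mul _ _ iN).
Qed.

Fact fps_mulC : commutative fps_mul.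
Proof. by move=> f g; apply/funext => n; rewrite !(tr_mul _ _ (ltnSn n)) mulrC. Qed.

Fact fps_mulA : associative fps_mul.
Proof.
move=> f g h; apply/funext => n; rewrite (fps_mulC f (fps_mul g h)).
by rewrite !(tr_mul _ _ (ltnSn n)) !(tr_mul3 _ _ _ (ltnSn n)) mulrC mulrA.
Qed.

Fact fps_mul1 : left_id fps_one fps_mul.
Proof.
move=> f; apply/funext => n; rewrite /fps_mul big_ord_recl mul1r subn0.
by rewrite big1 ?addr0 // => i _; rewrite mul0r.
Qed.

Fact fps_mulDl : left_distributive fps_mul +%R.
Proof.
move=> f g h; apply/funext => n; rewrite [RHS]/GRing.add /= -big_split /=.
by apply: eq_bigr => i _; rewrite -mulrDl.
Qed.

Fact fps_one_neq0 : fps_one != 0.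
Proof. by apply/eqP => /(congr1 (fun f => f 0%N))/eqP; rewrite (oner_eq0 R). Qed.

HB.instance Definition _ := GRing.Zmodule_isComNzRing.Build (fps R)
  fps_mulA fps_mulC fps_mul1 fps_mulDl fps_one_neq0.

Fact fps_scaleAl (a : R) f g : a *: (f * g) = a *: f * g.
Proof.
apply/funext => n; rewrite [LHS]/GRing.scale /= [LHS]mulr_sumr.
by apply: eq_bigr => i _; rewrite mulrA.
Qed.

HB.instance Definition _ :=
  GRing.Lmodule_isLalgebra.Build R (fps R) fps_scaleAl.

Definition fps_deriv f : fps R := fun n => f n.+1 *+ n.+1.

Definition principal_ideal g : {pred fps R} :=
  fun f => `[< exists h, f = g * h >].

Fact principal_ideal_closed g : submod_closed (principal_ideal g).
Proof.
split=> [|a x y /asboolP[p ->] /asboolP[q ->]]; apply/asboolP.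
  by exists 0; rewrite mulr0.
by exists (a *: p + q); rewrite mulrDr; congr (_ + _); rewrite ![g * _]mulrC scalerAl.
Qed.

End FPS.

Variant gen := Tau | Tee.

Definition gen_to_bool x := if x is Tau then true else false.
Definition bool_to_gen b := if b then Tau else Tee.
Fact gen_to_boolK : cancel gen_to_bool bool_to_gen. Proof. by case. Qed.
HB.instance Definition _ := Equality.copy gen (can_type gen_to_boolK).

(* All families of coefficients indexed by the words in tau and t; the product
   is the concatenation product, not the pointwise one. *)
Definition ncps (R : Type) := seq gen -> R.

Section NCPS.
Variable R : comNzRingType.
Implicit Types (f g h : ncps R) (u v : seq gen) (x y : gen).

HB.instance Definition _ := GRing.Lmodule.copy (ncps R) (seq gen -> R^o).

Definition ncps_one : ncps R := fun u => (u == [::])%:R.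
Definition ncps_mul f g : ncps R :=
  fun u => \sum_(i < (size u).+1) f (take i u) * g (drop i u).

(* f = f(1) + \sum_x x * shift x f *)
Definition shift x f : ncps R := fun u => f (x :: u).

Lemma ncps_mul_nil f g : ncps_mul f g [::] = f [::] * g [::].
Proof. by rewrite /ncps_mul big_ord_recl big_ord0 addr0. Qed.

Lemma ncps_mul_cons f g x u :
  ncps_mul f g (x :: u) = f [::] * g (x :: u) + ncps_mul (shift x f) g u.
Proof. by rewrite /ncps_mul big_ord_recl. Qed.

Fact ncps_mulDl : left_distributive ncps_mul +%R.
Proof.
move=> f g h; apply/funext => u; rewrite [RHS]/GRing.add /= -big_split /=.
by apply: eq_bigr => i _; rewrite -mulrDl.
Qed.

Fact ncps_mulDr : right_distributive ncps_mul +%R.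
Proof.
move=> f g h; apply/funext => u; rewrite [RHS]/GRing.add /= -big_split /=.
by apply: eq_bigr => i _; rewrite -mulrDr.
Qed.

Fact ncps_scaleAl (a : R) f g : a *: ncps_mul f g = ncps_mul (a *: f) g.
Proof.
apply/funext => u; rewrite [LHS]/GRing.scale /= [LHS]mulr_sumr.
by apply: eq_bigr => i _; rewrite mulrA.
Qed.

Fact ncps_scaleAr (a : R) f g : a *: ncps_mul f g = ncps_mul f (a *: g).
Proof.
apply/funext => u; rewrite [LHS]/GRing.scale /= [LHS]mulr_sumr.
by apply: eq_bigr => i _; rewrite mulrCA.
Qed.

Lemma shift_mul x f g :
  shift x (ncps_mul f g) = ncps_mul (shift x f) g + f [::] *: shift x g.
Proof. by apply/funext => u; rewrite /shift ncps_mul_cons addrC. Qed.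

Fact ncps_mulA : associative ncps_mul.
Proof.
move=> f g h; apply/funext => u; elim: u f => [|x u IHu] f.
  by rewrite !ncps_mul_nil mulrA.
rewrite !ncps_mul_cons ncps_mul_nil shift_mul ncps_mulDl -ncps_scaleAl.
rewrite [in RHS]/GRing.add /= {1}/GRing.scale /= -IHu mulrDr -!addrA mulrA.
by congr (_ + _); rewrite addrC.
Qed.

Fact ncps_mul1 : left_id ncps_one ncps_mul.
Proof.
move=> f; apply/funext => u; rewrite /ncps_mul big_ord_recl take0 drop0 mul1r.
by rewrite big1 ?addr0 // => i _; case: u i => [[]|y u i] //; rewrite mul0r.
Qed.

Fact ncps_1mul : right_id ncps_one ncps_mul.
Proof.
move=> f; apply/funext => u; rewrite /ncps_mul big_ord_recr /=.
rewrite take_size drop_size mulr1 big1 ?add0r // => i _.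
by rewrite /ncps_one -size_eq0 size_drop subn_eq0 leqNgt ltn_ord mulr0.
Qed.

Fact ncps_one_neq0 : ncps_one != 0.
Proof. by apply/eqP => /(congr1 (fun f => f [::]))/eqP; rewrite (oner_eq0 R). Qed.

HB.instance Definition _ := GRing.Zmodule_isNzRing.Build (ncps R)
  ncps_mulA ncps_mul1 ncps_1mul ncps_mulDl ncps_mulDr ncps_one_neq0.
HB.instance Definition _ :=
  GRing.Lmodule_isLalgebra.Build R (ncps R) ncps_scaleAl.
HB.instance Definition _ :=
  GRing.Lalgebra_isAlgebra.Build R (ncps R) ncps_scaleAr.

Definition var x : ncps R := fun u => (u == [:: x])%:R.

(* The inclusion of R[[t]] in R[[tau,t]] *)
Definition in_t (A : fps R) : ncps R :=
  fun u => if all (pred1 Tee) u then A (size u) else 0.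

End NCPS.

Arguments var {R} x.
Notation tau := (var Tau).
Notation tee := (var Tee).

Definition gdeg (d : int) (x : gen) : int := if x is Tau then -1 else - (d + 2).
Definition wdeg (d : int) (u : seq gen) : int := \sum_(x <- u) gdeg d x.
Definition oddz (n : int) : bool := odd `|n|%N.

Lemma oddzD m n : oddz (m + n) = oddz m (+) oddz n.
Proof.
rewrite /oddz; case: m n => m [] n; rewrite ?NegzE.
- by rewrite -PoszD !absz_nat oddD.
- by rewrite abszN !absz_nat; lia.
- by rewrite abszN !absz_nat; lia.
- by rewrite -opprD !abszN -PoszD !absz_nat oddD.
Qed.

Section Derivations.
Variables (R : comNzRingType) (d : int).
Implicit Types (f g A B : ncps R) (u : seq gen) (x y : gen) (p q : bool).

(* f is homogeneous of degree n: the coefficient of the word u lies in R_(n-|u|) *)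
Definition has_degree (Rg : int -> R -> Prop) (n : int) f : Prop :=
  forall u, Rg (n - wdeg d u) (f u).

(* The component of f of parity p; as R is evenly graded, only the degree of
   the words matters. *)
Definition part p f : ncps R := fun u => if oddz (wdeg d u) == p then f u else 0.

(* The p-derivation sending each generator x to F x, computed along
   f = f(1) + \sum_x x * shift x f:
   D f = \sum_x (F x * shift x f + (-1)^(p|x|) x * D (shift x f)). *)
Fixpoint pder_coef p (F : gen -> ncps R) f u : R :=
  (F Tau * shift Tau f + F Tee * shift Tee f) u +
  match u with
  | [::] => 0
  | y :: v => (-1) ^+ (p && oddz (gdeg d y)) * pder_coef p F (shift y f) v
  end.
Definition pder p F f : ncps R := pder_coef p F f.

(* A d/dtau + B d/dt: the sum over p of the p-derivations sending tau and t to
   the components of A and B of parities p + |tau| and p + |t|.  See der_tau,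
   der_tee, der_is_der and der_unique below. *)
Definition der (A B : ncps R) : ncps R -> ncps R := fun f =>
  \sum_(p : bool)
    pder p (fun x => part (p (+) oddz (gdeg d x)) (if x is Tau then A else B)) f.

(* Continuous derivations of parity p; continuity is with respect to the
   filtration by word length. *)
Record is_der p (D : ncps R -> ncps R) : Prop := {
  der_linear : linear D;
  der_cont : forall n, exists N, forall f,
    (forall u, (size u < N)%N -> f u = 0) ->
    forall u, (size u < n)%N -> D f u = 0;
  der_parity : forall q f, part q f = f -> part (p (+) q) (D f) = D f;
  der_leibniz : forall q f g, part q f = f ->
    D (f * g) = D f * g + (-1) ^+ (p && q) *: (f * D g)
}.

End Derivations.

Section DerivationTheory.
Variables (R : comNzRingType) (d : int).
Implicit Types (f g A B : ncps R) (u : seq gen) (x y : gen) (p q : bool).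
Implicit Types (F : gen -> ncps R).

Lemma ncpsD f g u : (f + g) u = f u + g u. Proof. by []. Qed.
Lemma ncpsN f u : (- f) u = - f u. Proof. by []. Qed.
Lemma ncpsZ (a : R) f u : (a *: f) u = a * f u. Proof. by []. Qed.
Lemma ncps0 u : (0 : ncps R) u = 0. Proof. by []. Qed.
Lemma ncpsM_nil f g : (f * g) [::] = f [::] * g [::].
Proof. exact: ncps_mul_nil. Qed.
Lemma ncpsM_cons f g x u :
  (f * g) (x :: u) = f [::] * g (x :: u) + (shift x f * g) u.
Proof. exact: ncps_mul_cons. Qed.
Lemma shiftM x f g : shift x (f * g) = shift x f * g + f [::] *: shift x g.
Proof. exact: shift_mul. Qed.

Lemma wdeg_nil : wdeg d [::] = 0. Proof. by rewrite /wdeg big_nil. Qed.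
Lemma wdeg_cons x u : wdeg d (x :: u) = gdeg d x + wdeg d u.
Proof. by rewrite /wdeg big_cons. Qed.

Lemma partP p f : part d p f = f <-> forall u, f u != 0 -> oddz (wdeg d u) = p.
Proof.
split=> [<- u|fp]; first by rewrite /part; case: ifP => [/eqP//|_]; rewrite eqxx.
apply/funext => u; rewrite /part; case: eqP => // ne.
by have [->//|/fp /ne] := eqVneq (f u) 0.
Qed.

Lemma part_linear p : linear (part d p : ncps R -> ncps R).
Proof.
move=> a f g; apply/funext => u; rewrite ncpsD ncpsZ /part ncpsD ncpsZ.
by case: ifP => //; rewrite mulr0 addr0.
Qed.
HB.instance Definition _ p :=
  GRing.isLinear.Build R (ncps R) (ncps R) *:%R (part d p) (@part_linear p).

Lemma part_part p q f : part d p (part d q f) = if p == q then part d p f else 0.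
Proof.
apply/funext => u; rewrite /part; case: (eqVneq p q) => [->|ne].
  by case: ifP => // ->.
by case: eqP => // ->; rewrite (negPf ne).
Qed.

Lemma part_sum f : \sum_(p : bool) part d p f = f.
Proof.
apply/funext => u; rewrite big_bool /= ncpsD /part.
by case: (oddz _); rewrite ?addr0 ?add0r.
Qed.

Lemma part_shift q x f : part d q f = f ->
  part d (q (+) oddz (gdeg d x)) (shift x f) = shift x f.
Proof.
move=> /partP fq; apply/partP => u /fq; rewrite wdeg_cons oddzD => <-.
by rewrite addbAC addbb.
Qed.

Lemma part_mul p q f g : part d p f = f -> part d q g = g ->
  part d (p (+) q) (f * g) = f * g.
Proof.
move=> /partP fp /partP gq; apply/partP => u.
elim: u p f fp => [|x u IHu] p f fp.
  rewrite ncpsM_nil => nz.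
  rewrite -(fp [::]) -?(gq [::]) ?wdeg_nil //; apply: contraNneq nz => ->.
    by rewrite mulr0.
  by rewrite mul0r.
rewrite ncpsM_cons; have [z|nz _] := eqVneq (f [::] * g (x :: u)) 0.
  rewrite z add0r wdeg_cons oddzD => nz.
  have -> := IHu (p (+) oddz (gdeg d x)) (shift x f) _ nz.
    by rewrite !addbA; case: p {fp}; case: q {gq IHu}; case: (oddz _).
  by move=> v /fp; rewrite wdeg_cons oddzD => <-; rewrite addbAC addbb.
rewrite -(fp [::]) -?(gq (x :: u)) ?wdeg_nil //; apply: contraNneq nz => ->.
  by rewrite mulr0.
by rewrite mul0r.
Qed.

Lemma pder_nil p F f :
  pder d p F f [::] = (F Tau * shift Tau f + F Tee * shift Tee f) [::].
Proof. exact: addr0. Qed.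
Lemma pder_cons p F f y u : pder d p F f (y :: u) =
  (F Tau * shift Tau f + F Tee * shift Tee f) (y :: u) +
  (-1) ^+ (p && oddz (gdeg d y)) * pder d p F (shift y f) u.
Proof. by []. Qed.

Lemma pder_linear p F : linear (pder d p F).
Proof.
have E x a f g : shift x (a *: f + g) = a *: shift x f + shift x g by [].
move=> a f g; apply/funext => u; elim: u f g => [|y u IHu] f g.
  rewrite ncpsD ncpsZ !pder_nil !E !mulrDr -!scalerAr !(ncpsD, ncpsZ); ring.
rewrite ncpsD ncpsZ !pder_cons !E IHu !mulrDr -!scalerAr !(ncpsD, ncpsZ); ring.
Qed.
HB.instance Definition _ p F :=
  GRing.isLinear.Build R (ncps R) (ncps R) *:%R (pder d p F) (@pder_linear p F).

Lemma pder_linearF p (a : R) F G f :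
  pder d p (fun x => a *: F x + G x) f = a *: pder d p F f + pder d p G f.
Proof.
apply/funext => u; elim: u f => [|y u IHu] f; rewrite ncpsD ncpsZ.
  by rewrite !pder_nil !mulrDl -!scalerAl !(ncpsD, ncpsZ); ring.
by rewrite !pder_cons IHu !mulrDl -!scalerAl !(ncpsD, ncpsZ); ring.
Qed.

Lemma pderF0 p f : pder d p (fun=> 0) f = 0.
Proof.
by have := pder_linearF p (-1) (fun=> 0) (fun=> 0) f;
   rewrite scaler0 addr0 scaleN1r addNr.
Qed.

Lemma pder_cont p F f n :
  (forall u, (size u < n.+1)%N -> f u = 0) ->
  forall u, (size u < n)%N -> pder d p F f u = 0.
Proof.
have M0 g h k : (forall u, (size u < k)%N -> h u = 0) ->
    forall u, (size u < k)%N -> (g * h) u = 0.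
  move=> h0 u uk; rewrite [LHS]big1 // => i _; rewrite h0 ?mulr0 //.
  by rewrite size_drop (leq_ltn_trans (leq_subr _ _)).
move=> f0 u; elim: u n f f0 => [|y u IHu] n f f0 un.
  by rewrite pder_nil ncpsD !(M0 _ _ n) ?addr0 // => v vn; apply: f0.
rewrite pder_cons ncpsD !(M0 _ _ n) ?add0r //; try by move=> v vn; apply: f0.
case: n f0 un => // n f0 un; rewrite (IHu n) ?mulr0 // => v vn.
exact: f0.
Qed.

Lemma pder_parity p F :
  (forall x, part d (p (+) oddz (gdeg d x)) (F x) = F x) ->
  forall q f, part d q f = f -> part d (p (+) q) (pder d p F f) = pder d p F f.
Proof.
move=> Fp q f fq; apply/partP => u.
have Sp q' g x : part d q' g = g ->
    part d (p (+) q') (F x * shift x g) = F x * shift x g.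
  move=> gq; have := part_mul (Fp x) (part_shift x gq).
  by rewrite addbACA addbb addbF.
elim: u q f fq => [|y u IHu] q f fq.
  rewrite pder_nil => nz.
  have /partP : part d (p (+) q) (F Tau * shift Tau f + F Tee * shift Tee f)
    = F Tau * shift Tau f + F Tee * shift Tee f by rewrite raddfD /= !Sp.
  exact.
rewrite pder_cons.
have [z|nz _] := eqVneq ((F Tau * shift Tau f + F Tee * shift Tee f) (y :: u)) 0.
  rewrite z add0r => nz.
  have nz' : pder d p F (shift y f) u != 0.
    by apply: contraNneq nz => ->; rewrite mulr0.
  rewrite wdeg_cons oddzD (IHu _ _ (part_shift y fq) nz').
  by rewrite addbC -!addbA addbb addbF.
have /partP : part d (p (+) q) (F Tau * shift Tau f + F Tee * shift Tee f)
  = F Tau * shift Tau f + F Tee * shift Tee f by rewrite raddfD /= !Sp.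
exact.
Qed.

Let twist p f : ncps R := fun u => (-1) ^+ (p && oddz (wdeg d u)) * f u.

Let pder_twist p F f g :
  pder d p F (f * g) = pder d p F f * g + twist p f * pder d p F g.
Proof.
pose S f := F Tau * shift Tau f + F Tee * shift Tee f.
have SM f' : S (f' * g) = S f' * g + f' [::] *: S g.
  rewrite /S !shiftM !mulrDr -!scalerAr !mulrA mulrDl scalerDr -!addrA.
  by congr (_ + _); rewrite addrCA.
have sD y f' : shift y (pder d p F f') =
    shift y (S f') + (-1) ^+ (p && oddz (gdeg d y)) *: pder d p F (shift y f').
  by [].
have sT y f' : shift y (twist p f') =
    (-1) ^+ (p && oddz (gdeg d y)) *: twist p (shift y f').
  apply/funext => u; rewrite ncpsZ /shift /twist wdeg_cons oddzD mulrA.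
  by rewrite andb_addr signr_addb.
apply/funext => u; elim: u f => [|y u IHu] f.
  rewrite ncpsD !ncpsM_nil !pder_nil -/(S f) -/(S (f * g)) -/(S g) SM.
  rewrite ncpsD ncpsZ ncpsM_nil /twist wdeg_nil /oddz absz0 andbF expr0 mul1r.
  by [].
rewrite ncpsD !ncpsM_cons sD sT !pder_cons -/(S f) -/(S g) -/(S (f * g)).
rewrite shiftM linearD linearZ /= ncpsD ncpsZ IHu SM ncpsD ncpsZ ncpsM_cons.
rewrite !mulrDl -!scalerAl !(ncpsD, ncpsZ).
rewrite /twist wdeg_nil /oddz absz0 andbF expr0 mul1r.
ring.
Qed.

Lemma pder_leibniz p F q f g : part d q f = f ->
  pder d p F (f * g) =
  pder d p F f * g + (-1) ^+ (p && q) *: (f * pder d p F g).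
Proof.
move=> /partP fq; rewrite pder_twist scalerAl; congr (_ + _ * _).
apply/funext => u; rewrite ncpsZ /twist.
by have [->|/fq ->//] := eqVneq (f u) 0; rewrite !mulr0.
Qed.

Lemma pder_is_der p F :
  (forall x, part d (p (+) oddz (gdeg d x)) (F x) = F x) ->
  is_der d p (pder d p F).
Proof.
move=> Fp; split.
- exact: pder_linear.
- by move=> n; exists n.+1 => f f0; apply: pder_cont.
- exact: pder_parity.
- exact: pder_leibniz.
Qed.

Lemma pder_var p F x : pder d p F (var x) = F x.
Proof.
have s1 y : shift y (var x) = (x == y)%:R :> ncps R.
  apply/funext => u; rewrite /shift /var eqseq_cons eq_sym.
  by case: eqP => //= _; rewrite ncps0.
have pd1 : pder d p F 1 = 0.
  have s0 y : shift y (1 : ncps R) = 0 by [].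
  apply/funext; case=> [|y u]; rewrite ?pder_nil ?pder_cons !s0 !mulr0 ?linear0 addr0 //.
  by rewrite mulr0 addr0.
apply/funext; case=> [|y u]; rewrite ?pder_nil ?pder_cons !s1.
  by case: x {s1}; rewrite mulr0 mulr1 ?addr0 ?add0r.
rewrite (_ : pder d p F (x == y)%:R = 0) ?mulr0 ?addr0; last first.
  by case: (x == y); rewrite ?linear0.
by case: x {s1}; rewrite mulr0 mulr1 ?addr0 ?add0r.
Qed.

Lemma part_var x : part d (oddz (gdeg d x)) (var x) = var x  :> ncps R.
Proof.
apply/partP => u; rewrite /var; case: (eqVneq u [:: x]) => [-> _|]; last by rewrite eqxx.
by rewrite wdeg_cons wdeg_nil addr0.
Qed.

Lemma is_der_ext p (D E : ncps R -> ncps R) :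
  is_der d p D -> is_der d p E -> (forall x, D (var x) = E (var x)) -> D = E.
Proof.
move=> [Dl _ _ DL] [El _ _ EL] DE.
have part1 : part d false (1 : ncps R) = 1.
  apply/partP; case=> [_|x u]; first by rewrite wdeg_nil.
  by rewrite /GRing.one /= /ncps_one eqxx.
have K1 (K : ncps R -> ncps R) : (forall q f g, part d q f = f ->
    K (f * g) = K f * g + (-1) ^+ (p && q) *: (f * K g)) -> K 1 = 0.
  move=> /(_ false 1 1 part1); rewrite andbF expr0 scale1r !mulr1 mul1r => e.
  by apply: (addIr (K 1)); rewrite add0r -e.
have dec f : f = f [::] *: 1 + \sum_(x <- [:: Tau; Tee]) var x * shift x f.
  have one u : (1 : ncps R) u = (u == [::])%:R by [].
  rewrite big_cons big_seq1; apply/funext => u; rewrite !ncpsD ncpsZ one.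
  have v0 x : (var x : ncps R) [::] = 0 by [].
  have sv x y : shift y (var x) = (x == y)%:R :> ncps R.
    apply/funext => v; rewrite /shift /var eqseq_cons eq_sym.
    by case: eqP => //= _; rewrite ncps0.
  case: u => [|y u]; first by rewrite !ncpsM_nil !v0 !mul0r mulr1 !addr0.
  rewrite !ncpsM_cons !v0 !mul0r mulr0 !add0r !sv.
  by case: y; rewrite /= mul0r mul1r ?addr0 ?add0r.
apply/funext => f; apply/funext => u.
have lin (K : ncps R -> ncps R) g h : linear K -> K (g + h) = K g + K h.
  by move=> Kl; have := Kl 1 g h; rewrite !scale1r.
have linZ (K : ncps R -> ncps R) a g : linear K -> K (a *: g) = a *: K g.
  move=> Kl; have K0 : K 0 = 0.
    by apply: (addIr (K 0)); rewrite add0r -(lin K) // addr0.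
  by have := Kl a g 0; rewrite !addr0 K0 addr0.
have ds (K : ncps R -> ncps R) g : linear K -> (forall q f g, part d q f = f ->
    K (f * g) = K f * g + (-1) ^+ (p && q) *: (f * K g)) ->
    K g = \sum_(x <- [:: Tau; Tee]) (K (var x) * shift x g +
      (-1) ^+ (p && oddz (gdeg d x)) *: (var x * K (shift x g))).
  move=> Kl KL; rewrite {1}(dec g) big_cons big_seq1 (lin K) // (lin K) // (linZ K) // (K1 K) //.
  by rewrite scaler0 add0r !(KL _ _ _ (part_var _)) big_cons big_seq1.
have v0 x : (var x : ncps R) [::] = 0 by [].
elim: u f => [|y u IHu] f; rewrite (ds D) // (ds E) // !big_cons !big_nil !DE.
  by rewrite !(ncpsD, ncpsZ) !ncpsM_nil !v0 !mul0r.
rewrite !(ncpsD, ncpsZ) !ncpsM_cons !v0 !mul0r !add0r.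
have sv x z : shift z (var x) = (x == z)%:R :> ncps R.
  apply/funext => v; rewrite /shift /var eqseq_cons eq_sym.
  by case: eqP => //= _; rewrite ncps0.
have K x (g h : ncps R) : g u = h u -> ((x == y)%:R * g) u = ((x == y)%:R * h) u.
  by case: eqP => _; rewrite ?mul1r ?mul0r.
by rewrite !sv !(K _ (D _) (E _) (IHu _)).
Qed.

Lemma der_linear_coef (a : R) A B A' B' :
  der d (a *: A + A') (a *: B + B') = a *: der d A B + der d A' B'.
Proof.
apply/funext => f; rewrite -[RHS]/(a *: der d A B f + der d A' B' f).
rewrite /der scaler_sumr -big_split; apply: eq_bigr => p _ /=.
rewrite -pder_linearF; congr (pder d p _ f).
by apply/funext => x; case: x; rewrite linearP.
Qed.

Lemma der_is_linear A B : linear (der d A B).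
Proof.
move=> a f g; rewrite /der scaler_sumr -big_split; apply: eq_bigr => p _ /=.
by rewrite linearP.
Qed.
HB.instance Definition _ A B :=
  GRing.isLinear.Build R (ncps R) (ncps R) *:%R (der d A B)
    (@der_is_linear A B).

Lemma der_tau A B : der d A B tau = A.
Proof.
rewrite /der -[RHS](part_sum A) !big_bool /= !pder_var.
by case: (oddz _) => //=; rewrite addrC.
Qed.

Lemma der_tee A B : der d A B tee = B.
Proof.
rewrite /der -[RHS](part_sum B) !big_bool /= !pder_var.
by case: (oddz _) => //=; rewrite addrC.
Qed.

Lemma der_is_der p A B :
  part d (p (+) oddz (gdeg d Tau)) A = A ->
  part d (p (+) oddz (gdeg d Tee)) B = B -> is_der d p (der d A B).
Proof.
move=> Ap Bp; pose F x := if x is Tau then A else B.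
have -> : der d A B = pder d p F; last first.
  by apply: pder_is_der => - [].
apply/funext => f; rewrite /der (bigD1 p) //= [X in _ + X]big1 ?addr0.
  by congr (pder d p _ f); apply/funext => - [].
move=> q qp; rewrite -[RHS](pderF0 q f); congr (pder d q _ f).
have neq b : (q (+) b == p (+) b) = false.
  by rewrite (can_eq (addbK b)) (negPf qp).
by apply/funext => - []; [rewrite -Ap | rewrite -Bp]; rewrite part_part neq.
Qed.

Lemma der_unique p (D : ncps R -> ncps R) :
  is_der d p D -> D = der d (D tau) (D tee).
Proof.
move=> dD; have Dx x := der_parity dD (part_var x).
apply: (is_der_ext dD (der_is_der (Dx Tau) (Dx Tee))).
by case; rewrite ?der_tau ?der_tee.
Qed.

End DerivationTheory.

Section Moore.
Variables (R : comNzRingType) (d : int).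
Implicit Types (f A B : ncps R) (D m : ncps R -> ncps R) (p q : bool).

(* \sum_(i >= 1) c_i t^(2i) *)
Definition even_series (c : nat -> R) : fps R :=
  fun n => if (0 < n)%N && ~~ odd n then c n./2 else 0.

(* \sum_(i >= 1) c_i t^i *)
Definition tilde_series (c : nat -> R) : fps R :=
  fun n => if (0 < n)%N then c n else 0.

(* f |-> [tau, f], where tau is odd *)
Definition ad_tau f : ncps R :=
  \sum_(q : bool) (tau * part d q f - (-1) ^+ q *: (part d q f * tau)).

(* An odd Moore algebra is encoded by the coefficients of v(t) and w(t); the
   values of these functions at 0 are irrelevant. *)
Record odd_moore (Rg : int -> R -> Prop) := OddMoore {
  moore_v : nat -> R;
  moore_w : nat -> R;
  moore_v_degree : has_degree d Rg (- (d + 3)) (in_t (even_series moore_v));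
  moore_w_degree : has_degree d Rg (- 2) (in_t (even_series moore_w))
}.

Definition moore_m (Rg : int -> R -> Prop) (A : odd_moore Rg) :
    ncps R -> ncps R := fun f =>
  der d 0 (in_t (even_series (moore_v A))) f +
  der d (in_t (even_series (moore_w A))) 0 f +
  ad_tau f - der d (tau ^+ 2) 0 f.

(* The component of parity p of an endomorphism of R[[tau,t]] *)
Definition op_part p D : ncps R -> ncps R :=
  fun f => \sum_(q : bool) part d (p (+) q) (D (part d q f)).

(* D |-> [D, m] for m of odd degree, on not necessarily homogeneous D *)
Definition hoch_diff m D : ncps R -> ncps R := fun f =>
  \sum_(p : bool) (op_part p D (m f) - (-1) ^+ p *: m (op_part p D f)).

(* The normalised derivations A(t) d/dtau + B(t) d/dt *)
Definition cochains : {pred (ncps R -> ncps R)} := fun D =>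
  `[< exists A B : fps R,
      [/\ A 0%N = 0, B 0%N = 0 & D = der d (in_t A) (in_t B)] >].

Lemma ad_tau_linear : linear ad_tau.
Proof.
move=> a f g; rewrite /ad_tau scaler_sumr -big_split; apply: eq_bigr => q _ /=.
rewrite linearP /= mulrDr mulrDl -scalerAr -scalerAl -!scaleNr !scalerDr.
by rewrite addrACA; congr (_ + _ + _); rewrite !scalerA mulrC.
Qed.

Lemma moore_m_linear (Rg : int -> R -> Prop) (A : odd_moore Rg) :
  linear (moore_m A).
Proof.
move=> a f g; rewrite /moore_m !linearP ad_tau_linear /=.
by apply/funext => u; rewrite !(ncpsD, ncpsN, ncpsZ); ring.
Qed.
HB.instance Definition _ (Rg : int -> R -> Prop) (A : odd_moore Rg) :=
  GRing.isLinear.Build R (ncps R) (ncps R) *:%R (moore_m A) (moore_m_linear A).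

Lemma in_t_linear : linear (@in_t R).
Proof.
move=> a f g; apply/funext => u; rewrite ncpsD ncpsZ /in_t.
by case: ifP => // _; rewrite mulr0 addr0.
Qed.

Lemma op_part_linear p : linear (op_part p).
Proof.
move=> a D E; apply/funext => f.
rewrite -[RHS]/(a *: op_part p D f + op_part p E f) /op_part.
by rewrite scaler_sumr -big_split; apply: eq_bigr => q _; exact: part_linear.
Qed.

Lemma hoch_diff_linear m : linear m -> linear (hoch_diff m).
Proof.
move=> ml a D E; apply/funext => f.
rewrite -[RHS]/(a *: hoch_diff m D f + hoch_diff m E f) /hoch_diff.
rewrite scaler_sumr -big_split; apply: eq_bigr => p _ /=.
rewrite op_part_linear.
rewrite -![(a *: _ + _ : ncps R -> ncps R) _]/(a *: op_part p D _ + op_part p E _).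
rewrite ml -!scaleNr !scalerDr addrACA.
by congr (_ + _ + _); rewrite !scalerA mulrC.
Qed.

Lemma cochains_closed : submod_closed cochains.
Proof.
split=> [|a D E /asboolP[A [B [A0 B0 ->]]] /asboolP[A' [B' [A'0 B'0 ->]]]];
  apply/asboolP.
  exists 0, 0; split=> //.
  have i0 : in_t (0 : fps R) = 0.
    by apply/funext => u; rewrite /in_t; case: ifP.
  rewrite i0; have := der_linear_coef d (-1) (0 : ncps R) 0 0 0.
  by rewrite scaler0 addr0 => ->; rewrite scaleN1r addNr.
exists (a *: A + A'), (a *: B + B'); split.
- by rewrite -[LHS]/(a * A 0%N + A' 0%N) A0 A'0 mulr0 addr0.
- by rewrite -[LHS]/(a * B 0%N + B' 0%N) B0 B'0 mulr0 addr0.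
- by rewrite !in_t_linear der_linear_coef.
Qed.

Section Cohomology.
Variables (Rg : int -> R -> Prop) (A : odd_moore Rg).

Definition cocycles : {pred (ncps R -> ncps R)} := fun D =>
  (D \in cochains) && `[< hoch_diff (moore_m A) D = 0 >].

Lemma cocycles_closed : submod_closed cocycles.
Proof.
have dl := hoch_diff_linear (moore_m_linear A).
split=> [|a D E /andP[DC /asboolP dD] /andP[EC /asboolP dE]].
  apply/andP; split; first exact: cochains_closed.1.
  have /= := dl (-1) 0 0; rewrite scaler0 addr0 scaleN1r addNr => dl0.
  exact/asboolP.
apply/andP; split; first exact: cochains_closed.2.
by apply/asboolP; rewrite dl dD dE scaler0 addr0.
Qed.
HB.instance Definition _ :=
  GRing.isSubmodClosed.Build R (ncps R -> ncps R) cocycles cocycles_closed.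

Definition cocycle := {D : ncps R -> ncps R | D \in cocycles}.
HB.instance Definition _ := SubChoice.on cocycle.
HB.instance Definition _ := [SubChoice_isSubLmodule of cocycle by <:].

Definition coboundaries : {pred cocycle} := fun z =>
  `[< exists2 D, D \in cochains & val z = hoch_diff (moore_m A) D >].

Lemma coboundaries_closed : submod_closed coboundaries.
Proof.
have dl := hoch_diff_linear (moore_m_linear A).
split=> [|a y z /asboolP[D DC yD] /asboolP[E EC zE]]; apply/asboolP.
  exists 0; first exact: cochains_closed.1.
  have /= := dl (-1) 0 0; rewrite scaler0 addr0 scaleN1r addNr => ->.
  exact: (raddf0 (\val : cocycle -> _)).
exists (a *: D + E); first exact: cochains_closed.2.
by rewrite dl -yD -zE linearP.
Qed.

Definition HH := lmod_quot coboundaries_closed.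

End Cohomology.
End Moore.

(* Main.v *)
From HB Require Import structures.
Require Import Defs.
From mathcomp Require Import all_boot all_order all_algebra.
From mathcomp Require Import zify ring boolp functions.

Set Implicit Arguments.
Unset Strict Implicit.
Unset Printing Implicit Defensive.

Import GRing.Theory.
Local Open Scope ring_scope.

(** The proof computes the Hochschild differential of xi = A d/dtau + B d/dt
    explicitly.  Since d is odd both generators are odd, while R is even, so the
    parity of a term is that of the length of its word; hence the component
    of xi of parity p has as coefficients the terms of A and B whose exponent
    has parity p + 1.  On the generators,
      m(tau) = tau^2 + w(t),  m(t) = tau t + t tau,
    and m acts on R[[t]] as the graded commutator with tau.  In [xi, m] all the
    terms that involve tau cancel, and what is left, for xi of parity p, is
      tau |-> xi(w(t)),  t |-> A t + (-1)^p t A.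
    For p odd both vanish: A and t commute, and xi(t^2) = B t - t B = 0 while w
    only involves t^2.  For p even they are w'(t) B(t) and 2 t A(t)
    ([hoch_diff_in_t]).

    Write V for the derivative of \tilde w, so that w'(t) = 2 t V(t^2).
    The leading coefficient of V is k w_k, which is not a zero divisor, hence
    V is regular.  As 2 is invertible, xi is a cocycle exactly when A and B
    are even in t ([cocycle_lift]), say A = t^2 a(t^2) and B = t^2 b(t^2).
    The even pairs that are coboundaries are those coming from
    A = t a0(t^2) and B = t b0(t^2), which give a = 2 V b0 and b = 2 a0.
    Therefore b can always be killed, and a counts modulo V: the map xi |-> a
    from cocycles to R[[t]] is onto, and it sends exactly the coboundaries into
    the ideal (V) ([coboundary_class_series]). *)

(** * Quotient modules *)

Lemma lmod_quot_iso (R : pzRingType) (V W : lmodType R) (S : {pred V})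
    (T : {pred W}) (clS : submod_closed S) (clT : submod_closed T)
    (F : {linear V -> W}) :
  (forall x, x \in S <-> F x \in T) -> (forall y, exists x, F x = y) ->
  exists phi : {linear lmod_quot clS -> lmod_quot clT}, bijective phi.
Proof.
move=> FS Fsurj.
pose g (q : lmod_quot clS) : lmod_quot clT := to_quot clT (F (repr q)).
have gE x : g (to_quot clS x) = to_quot clT (F x).
  apply/to_quot_eq; rewrite -raddfB; apply/FS/to_quot_eq; exact: to_quotK.
have g_lin : linear g.
  move=> a p q; rewrite -[p]to_quotK -[q]to_quotK -linearP !gE.
  by rewrite -linearP linearP.
pose gL := GRing.isLinear.Build _ _ _ _ g g_lin.
pose phi : {linear lmod_quot clS -> lmod_quot clT} := HB.pack g gL.
have [G FG] : {G : W -> V | forall y, F (G y) = y}.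
  by exists (fun y => sval (cid (Fsurj y))) => y; case: cid.
exists phi; exists (fun q : lmod_quot clT => to_quot clS (G (repr q))) => q.
  rewrite -[q]to_quotK [phi _]gE; apply/to_quot_eq/FS.
  by rewrite raddfB /= FG; apply/to_quot_eq; rewrite to_quotK.
by rewrite [phi _]gE FG to_quotK.
Qed.

(** * Power series in t and their even and odd parts *)

Section Series.
Variable R : comNzRingType.
Implicit Types f g h : fps R.

Definition fps_tail f : fps R := fun n => f n.+1.
Definition fpsX : fps R := fun n => (n == 1%N)%:R.
(** f(t^2) *)
Definition stretch f : fps R := fun n => if odd n then 0 else f n./2.
(** The series g with t g(t^2) the odd part of f *)
Definition odd_half f : fps R := fun n => f n.*2.+1.
(** The series g with t^2 g(t^2) the even part of f - f(0) *)
Definition even_half f : fps R := fun n => f n.*2.+2.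
Definition fpart q f : fps R := fun n => if odd n == q then f n else 0.

Lemma fpsD f g n : (f + g) n = f n + g n. Proof. by []. Qed.
Lemma fpsZ a f n : (a *: f) n = a * f n. Proof. by []. Qed.

Lemma fps_mulZr a f g : f * (a *: g) = a *: (f * g).
Proof. by rewrite mulrC -scalerAl mulrC. Qed.

Lemma fpsM_0 f g : (f * g) 0%N = f 0%N * g 0%N.
Proof. by rewrite [LHS]big_ord_recl big_ord0 addr0. Qed.

Lemma fpsM_S f g n : (f * g) n.+1 = f 0%N * g n.+1 + (fps_tail f * g) n.
Proof. by rewrite [LHS]big_ord_recl. Qed.

Lemma fpsXM f n : (fpsX * f) n = if n is n'.+1 then f n' else 0.
Proof.
case: n => [|n]; first by rewrite fpsM_0 mul0r.
by rewrite fpsM_S mul0r add0r (_ : fps_tail fpsX = 1) ?mul1r.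
Qed.

(** Applying the product formula on the first coefficient twice shifts the
    stretched series by t^2, that is, shifts f by t; so the coefficients of
    degrees n and n + 1 are handled together. *)
Lemma stretchM f g : stretch (f * g) = stretch f * stretch g.
Proof.
suff H n h : (stretch (h * g) n = (stretch h * stretch g) n) /\
    (stretch (h * g) n.+1 = (stretch h * stretch g) n.+1).
  by apply/funext => n; case: (H n f).
elim: n h => [|n IHn] h.
  rewrite fpsM_S !fpsM_0 /stretch /fps_tail /= fpsM_0; split=> //.
  by rewrite mulr0 mul0r addr0.
split; first by case: (IHn h).
have tt : fps_tail (fps_tail (stretch h)) = stretch (fps_tail h).
  by apply/funext => i; rewrite /fps_tail /stretch /= negbK.
rewrite !fpsM_S tt -(IHn _).1 /stretch /= negbK {2}/fps_tail /= mul0r add0r.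
by case: ifP => _; rewrite ?mulr0 ?addr0 // fpsM_S.
Qed.

Lemma stretchZ a f : stretch (a *: f) = a *: stretch f.
Proof.
by apply/funext => n; rewrite fpsZ /stretch; case: ifP; rewrite ?mulr0.
Qed.

(** t^2 f(t^2), where multiplication by t^2 kills the constant term: the even
    series that may occur as coefficients of a normalised derivation *)
Definition even_lift f : fps R := fpsX * (fpsX * stretch f).

Lemma even_liftE f n :
  even_lift f n =
  if (0 < n)%N && ~~ odd n then f n./2.-1 else 0.
Proof.
by case: n => [|[|n]]; rewrite /even_lift !fpsXM //= /stretch negbK; case: odd.
Qed.

Lemma even_half_lift f : even_half (even_lift f) = f.
Proof.
apply/funext => n; rewrite /even_half even_liftE /= odd_double /=.
by rewrite doubleK.
Qed.

Lemma odd_half_Xstretch f : odd_half (fpsX * stretch f) = f.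
Proof.
by apply/funext => n; rewrite /odd_half fpsXM /stretch odd_double doubleK.
Qed.

Lemma fpart_true f : fpart true f = fpsX * stretch (odd_half f).
Proof.
apply/funext => -[|n]; rewrite fpsXM /fpart //= /stretch /odd_half eqb_id.
by case: (boolP (odd n)) => //= o; rewrite even_halfK.
Qed.

Lemma odd_half_lift f : odd_half (even_lift f) = 0.
Proof. by apply/funext => n; rewrite /odd_half even_liftE /= odd_double. Qed.

Lemma even_lift0 : even_lift 0 = 0.
Proof. by apply/funext => n; rewrite even_liftE if_same. Qed.

Lemma even_lift_half f :
  f 0%N = 0 -> odd_half f = 0 -> f = even_lift (even_half f).
Proof.
move=> f0 fodd; apply/funext => n; rewrite even_liftE /even_half.
case: n => [//|n] /=; case: (boolP (odd n)) => /= no.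
  by rewrite uphalfE; congr (f _); lia.
by have := congr1 (fun h => h n./2) fodd; rewrite /odd_half even_halfK // => ->.
Qed.

Lemma even_lift_eq0 f : even_lift f = 0 -> f = 0.
Proof. by move=> f0; rewrite -[f]even_half_lift f0. Qed.

End Series.

(** A series whose leading coefficient is not a zero divisor is not a zero
    divisor: the lowest term of a product is the product of the lowest terms. *)
Lemma fps_reg (R : comNzRingType) (f g : fps R) N :
  (forall i, (i < N)%N -> f i = 0) -> (forall r, f N * r = 0 -> r = 0) ->
  f * g = 0 -> g = 0.
Proof.
move=> f0 fN fg0; apply/funext => n; elim/ltn_ind: n => n IHn.
have NNn : (N < (N + n).+1)%N by rewrite ltnS leq_addr.
apply: fN; have := congr1 (fun h => h (N + n)%N) fg0.
rewrite [X in X = _](bigD1 (Ordinal NNn)) //= addKn big1 ?addr0 // => i iN.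
have [lt|gt|e] := ltngtP i N; first by rewrite f0 ?mul0r.
  by rewrite IHn ?mulr0 //; have := ltn_ord i; lia.
by case/eqP: iN; apply: val_inj.
Qed.

(** * The inclusion of R[[t]] in R[[tau,t]] *)

Section Inclusion.
Variable R : comNzRingType.
Implicit Types f g : fps R.

Lemma shift_tau_in_t f : shift Tau (in_t f) = 0.
Proof. by []. Qed.

Lemma shift_tee_in_t f : shift Tee (in_t f) = in_t (fps_tail f).
Proof. by []. Qed.

Lemma in_t0 : in_t (0 : fps R) = 0.
Proof. by apply/funext => u; rewrite /in_t; case: ifP. Qed.

Lemma in_tD f g : in_t (f + g) = in_t f + in_t g.
Proof. by have := in_t_linear 1 f g; rewrite !scale1r. Qed.

Lemma in_tZ a f : in_t (a *: f) = a *: in_t f.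
Proof. by have := in_t_linear a f 0; rewrite in_t0 !addr0. Qed.

Lemma in_tM f g : in_t (f * g) = in_t f * in_t g.
Proof.
apply/funext => u; elim: u f => [|x u IHu] f.
  by rewrite ncpsM_nil [LHS]fpsM_0.
rewrite ncpsM_cons; case: x; last rewrite shift_tee_in_t -IHu.
  by rewrite shift_tau_in_t mul0r addr0 [in_t g _]/= mulr0.
rewrite /in_t /=; case: ifP => _; last by rewrite mulr0 addr0.
exact: fpsM_S.
Qed.

Lemma in_tX : in_t (fpsX R) = tee.
Proof.
apply/funext => -[|[] [|[] u]] //=; rewrite /in_t /var //=.
by case: ifP.
Qed.

Lemma in_t_comm f g : in_t f * in_t g = in_t g * in_t f.
Proof. by rewrite -!in_tM mulrC. Qed.

Lemma in_t_inj : injective (@in_t R).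
Proof.
move=> f g /(congr1 (fun h => h (nseq _ Tee))) e; apply/funext => n.
by have := e n; rewrite /in_t all_nseq orbT size_nseq.
Qed.

End Inclusion.

(** * Commutators of derivations *)

Section Commutator.
Variables (R : comNzRingType) (d : int).
Implicit Types (f g : ncps R) (D E : ncps R -> ncps R) (p q : bool).

Lemma is_der_sum p D E : is_der d p D -> is_der d p E -> is_der d p (D + E).
Proof.
move=> [Dl Dc Dp DL] [El Ec Ep EL]; split.
- move=> a f g; rewrite -[LHS]/(D _ + E _) Dl El.
  by rewrite -[(D + E) f]/(D _ + E _) scalerDr addrACA.
- move=> n; have [N DN] := Dc n; have [M EM] := Ec n.
  exists (maxn N M) => f f0 u un; rewrite -[LHS]/(D f u + E f u).
  by rewrite DN ?EM ?addr0 // => v vN; apply: f0; rewrite leq_max vN ?orbT.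
- move=> q f fq; rewrite -[(D + E) f]/(D f + E f).
  by rewrite raddfD /= Dp ?Ep.
- move=> q f g fq; rewrite -![(D + E) _]/(D _ + E _) (DL q) // (EL q) //.
  by rewrite mulrDl mulrDr scalerDr addrACA.
Qed.

Lemma is_der_scale p (a : R) D : is_der d p D -> is_der d p (a *: D).
Proof.
move=> [Dl Dc Dp DL]; split.
- by move=> b f g; rewrite -![(a *: D) _]/(a *: D _) Dl scalerDr !scalerA mulrC.
- move=> n; have [N DN] := Dc n.
  by exists N => f f0 u un; rewrite -[LHS]/(a * D f u) DN ?mulr0.
- by move=> q f fq; rewrite -[(a *: D) f]/(a *: D f) linearZ /= Dp.
- move=> q f g fq; rewrite -![(a *: D) _]/(a *: D _) (DL q) // scalerDr.
  by rewrite -scalerAl -scalerAr !scalerA mulrC.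
Qed.

Lemma is_derD p D f g : is_der d p D -> D (f + g) = D f + D g.
Proof. by move=> dD; have := der_linear dD 1 f g; rewrite !scale1r. Qed.

Lemma is_der0 p D : is_der d p D -> D 0 = 0.
Proof.
by move=> dD; apply: (addIr (D 0)); rewrite -(is_derD _ _ dD) !add0r.
Qed.

Lemma is_derZ p D a f : is_der d p D -> D (a *: f) = a *: D f.
Proof.
by move=> dD; have := der_linear dD a f 0; rewrite (is_der0 dD) !addr0.
Qed.

(** This is what makes [xi, m] computable: being a derivation, it is determined
    by its values on the two generators. *)
Lemma is_der_commutator p q D E : is_der d p D -> is_der d q E ->
  is_der d (p (+) q) (fun f => D (E f) - (-1) ^+ (p && q) *: E (D f)).
Proof.
move=> dD dE; have [[Dl Dc Dp DL] [El Ec Ep EL]] := (dD, dE); split.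
- move=> a f g; rewrite El Dl Dl El scalerDr opprD addrACA scalerBr.
  by rewrite !scalerA [a * _]mulrC.
- move=> n; have [N1 DN1] := Dc n; have [N2 EN2] := Ec N1.
  have [M1 EM1] := Ec n; have [M2 DM2] := Dc M1.
  exists (maxn N2 M2) => f f0 u un; rewrite ncpsD ncpsN ncpsZ.
  rewrite DN1 ?EM1 ?mulr0 ?subr0 // => v vn.
    by apply: DM2 => // v' vN; apply: f0; rewrite leq_max vN orbT.
  by apply: EN2 => // v' vN; apply: f0; rewrite leq_max vN.
- move=> r f fr; rewrite raddfB /= [part _ _ (_ *: _)]linearZ /=.
  have -> : part d (p (+) q (+) r) (D (E f)) = D (E f).
    by rewrite -addbA Dp //; exact: Ep.
  have -> : part d (p (+) q (+) r) (E (D f)) = E (D f) => //.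
  by rewrite -addbA addbCA Ep //; exact: Dp.
- move=> r f g fr.
  rewrite (EL r) // (DL r) // !(is_derD _ _ dD, is_derD _ _ dE).
  rewrite !(is_derZ _ _ dD, is_derZ _ _ dE).
  rewrite (DL _ _ _ (Ep _ _ fr)) (EL _ _ _ (Dp _ _ fr)) (DL r) // (EL r) //.
  rewrite !mulrBl !mulrBr -!scalerAl -!scalerAr.
  apply/funext => u; rewrite !(ncpsD, ncpsN, ncpsZ).
  by case: p q r {fr dD dE Dp DL Ep EL} => [] [] [] /=; ring.
Qed.

Lemma op_part_is_der p q D : is_der d p D ->
  op_part d q D = if q == p then D else 0.
Proof.
move=> dD; apply/funext => f; rewrite /op_part.
have H r : part d (q (+) r) (D (part d r f)) =
    if q == p then D (part d r f) else 0.
  have fr : part d r (part d r f) = part d r f by rewrite part_part eqxx.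
  rewrite -(der_parity dD fr) part_part (can_eq (addbK r)).
  by case: eqP => // ->.
under eq_bigr do rewrite H.
case: eqP => _; last by rewrite big1.
by rewrite big_bool /= -(is_derD _ _ dD) -{3}(part_sum d f) big_bool.
Qed.

End Commutator.

(** * The inner derivation ad tau *)

Section AdTau.
Variables (R : comNzRingType) (d : int).
Hypothesis odd_d : odd `|d|%N.
Implicit Types (f g : ncps R) (p q : bool) (x : gen).

Lemma oddz_gdeg x : oddz (gdeg d x) = true.
Proof. by case: x; rewrite /oddz /gdeg //; lia. Qed.

Lemma oddz_wdeg u : oddz (wdeg d u) = odd (size u).
Proof.
by elim: u => [|x u IHu]; rewrite ?wdeg_nil // wdeg_cons oddzD oddz_gdeg IHu.
Qed.

Lemma part_gen x : part d true (var x) = var x :> ncps R.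
Proof. by rewrite -[RHS](part_var R d x) oddz_gdeg. Qed.

Lemma ad_tau_part q f : part d q f = f ->
  ad_tau d f = tau * f - (-1) ^+ q *: (f * tau).
Proof.
move=> fq; rewrite /ad_tau big_bool /= -fq !part_part.
by case: q {fq} => /=; rewrite !mulr0 mul0r scaler0 subr0 ?add0r ?addr0.
Qed.

Lemma ad_tauD f g : ad_tau d (f + g) = ad_tau d f + ad_tau d g.
Proof. by have := ad_tau_linear d 1 f g; rewrite !scale1r. Qed.

Lemma ad_tau_is_der : is_der d true (@ad_tau R d).
Proof.
split.
- exact: ad_tau_linear.
- move=> n; exists n => f f0 u un.
  have f0' v : (size v <= size u)%N -> f v = 0.
    by move=> vu; apply: f0; apply: leq_ltn_trans vu un.
  have p0 q v : (size v <= size u)%N -> part d q f v = 0.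
    by move=> vu; rewrite /part f0' // if_same.
  have l0 q : (tau * part d q f) u = 0.
    by rewrite [LHS]big1 // => i _; rewrite p0 ?mulr0 // size_drop leq_subr.
  have r0 q : (part d q f * tau) u = 0.
    by rewrite [LHS]big1 // => i _; rewrite p0 ?mul0r // size_take_min geq_minr.
  by rewrite /ad_tau big_bool /= !(ncpsD, ncpsN, ncpsZ) !l0 !r0; ring.
- move=> q f fq; rewrite (ad_tau_part fq) raddfB /=.
  rewrite [part _ _ (_ *: _)]linearZ /= -(addTb q).
  by rewrite (part_mul (part_gen Tau) fq) addbC (part_mul fq (part_gen Tau)).
- (* ad tau has a closed form on homogeneous elements only; the rule is linear
     in g, so g is split into its components. *)
  move=> q f g fq; rewrite -(part_sum d g) big_bool /= mulrDr !ad_tauD.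
  have H r : ad_tau d (f * part d r g) =
      ad_tau d f * part d r g +
      (-1) ^+ (true && q) *: (f * ad_tau d (part d r g)).
    have hr : part d r (part d r g) = part d r g by rewrite part_part eqxx.
    rewrite (ad_tau_part (part_mul fq hr)) (ad_tau_part fq).
    rewrite (ad_tau_part hr) !mulrBr !mulrBl -!scalerAl -!scalerAr !mulrA.
    apply/funext => u; rewrite !(ncpsD, ncpsN, ncpsZ).
    by case: q r {fq hr} => [] [] /=; ring.
  by rewrite !H !mulrDr !scalerDr addrACA.
Qed.

End AdTau.

(** * The Hochschild differential *)

Section Differential.
Variables (R : comNzRingType) (d : int).
Hypothesis odd_d : odd `|d|%N.
Implicit Types (f A B W : fps R) (D m : ncps R -> ncps R) (p q : bool).

Lemma fpart_sum f : fpart true f + fpart false f = f.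
Proof.
by apply/funext => n; rewrite fpsD /fpart; case: odd; rewrite ?addr0 ?add0r.
Qed.

Lemma fpart_idem q f : fpart q (fpart q f) = fpart q f.
Proof. by apply/funext => n; rewrite /fpart; case: eqP. Qed.

Lemma part_in_t q f : part d q (in_t f) = in_t (fpart q f).
Proof.
apply/funext => u; rewrite /part /in_t /fpart oddz_wdeg //.
by case: eqP; case: all.
Qed.

(** The shift of parity comes from d/dtau and d/dt, which are odd. *)
Lemma der_in_t_is_der p A B : fpart (~~ p) A = A -> fpart (~~ p) B = B ->
  is_der d p (der d (in_t A) (in_t B)).
Proof.
by move=> Ap Bp; apply: der_is_der;
   rewrite oddz_gdeg // addbT part_in_t ?Ap ?Bp.
Qed.

(** The effect of a derivation of parity p on R[[t]]: when xi has parity p and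
    xi(t) = B is in R[[t]], xi(t^(n+1)) is the sum of (-1)^(p i) t^n B over
    i <= n, and that sum of signs is n + 1 for p even; for p odd it is 1 or 0
    according as n is even or odd. *)
Definition qderiv p f : fps R :=
  fun n => if p then (if odd n then 0 else f n.+1) else f n.+1 *+ n.+1.

(** The graded Leibniz rule for f = f(0) + t * tail(f) *)
Lemma qderiv_rec p f :
  qderiv p f = fps_tail f + (-1) ^+ p *: (fpsX R * qderiv p (fps_tail f)).
Proof.
apply/funext => -[|n]; rewrite fpsD fpsZ fpsXM /qderiv /fps_tail.
  by rewrite mulr0 addr0; case: p.
case: p => /=; last by rewrite expr0 mul1r mulrS.
by case: odd; rewrite /= ?mulr0 ?addr0 // expr1 mulN1r addrN.
Qed.

Lemma qderiv_true W : fpart false W = W -> qderiv true W = 0.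
Proof.
move=> <-; apply/funext => n; rewrite /qderiv /fpart /=.
by case: odd.
Qed.

(** A power series is not a finite combination of monomials, so the Leibniz rule
    is not enough; the coefficient of each word is computed by peeling off its
    first letter, where [qderiv_rec] matches the recursion defining [pder]. *)
Lemma pder_in_t p F B f : F Tee = in_t B ->
  pder d p F (in_t f) = in_t (qderiv p f * B).
Proof.
move=> FB; apply/funext => u; elim: u f => [|x u IHu] f;
  rewrite ?pder_nil ?pder_cons shift_tau_in_t shift_tee_in_t mulr0 add0r FB.
  rewrite -in_tM mulrC [qderiv p f]qderiv_rec mulrDl in_tD -scalerAl in_tZ.
  rewrite ncpsD ncpsZ -[fpsX R * _ * _]mulrA [in_t (fpsX R * _)]in_tM in_tX.
  by rewrite ncpsM_nil mul0r mulr0 addr0.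
rewrite [qderiv p f]qderiv_rec mulrDl in_tD -scalerAl in_tZ ncpsD ncpsZ.
rewrite -in_tM -[fpsX R * _ * _]mulrA [B * _]mulrC; congr (_ + _).
rewrite oddz_gdeg // andbT; congr (_ * _); case: x; last first.
  by rewrite shift_tee_in_t IHu [RHS]/in_t /= fpsXM.
by rewrite shift_tau_in_t raddf0.
Qed.


(** Since m differs from ad tau by multiples of d/dtau, it follows that m acts
    on R[[t]] as ad tau. *)
Lemma der_in_t (C : ncps R) A : der d C 0 (in_t A) = 0.
Proof.
rewrite /der big1 // => p _.
rewrite (@pder_in_t p _ 0) ?mulr0 ?in_t0 //.
by rewrite raddf0.
Qed.

Definition moore_map W : ncps R -> ncps R := fun f : ncps R =>
  ad_tau d f - der d (tau ^+ 2) 0 f + der d (in_t W) 0 f.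

Section EvenW.
Variable W : fps R.
Hypothesis W_even : fpart false W = W.
Let m := moore_map W.

Lemma moore_map_is_der : is_der d true m.
Proof.
have -> : m = ad_tau d + (-1) *: der d (tau ^+ 2) 0 + der d (in_t W) 0.
  by apply/funext => f; rewrite /m /moore_map scaleN1r.
apply: is_der_sum; first apply: is_der_sum; first exact: ad_tau_is_der.
  apply: is_der_scale; apply: der_is_der; last by rewrite raddf0.
  rewrite oddz_gdeg //; apply: (part_mul (part_gen R odd_d Tau)).
  exact: part_gen.
by apply: der_is_der; rewrite ?raddf0 // oddz_gdeg // part_in_t W_even.
Qed.

Lemma moore_map_tau : m tau = tau * tau + in_t W.
Proof.
rewrite /m /moore_map !der_tau (ad_tau_part (part_gen R odd_d Tau)).
by rewrite expr1 scaleN1r opprK expr2 addrK.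
Qed.

Lemma moore_map_tee : m tee = tau * tee + tee * tau.
Proof.
rewrite /m /moore_map !der_tee (ad_tau_part (part_gen R odd_d Tee)).
by rewrite expr1 scaleN1r opprK subr0 addr0.
Qed.

Lemma moore_map_in_t q A : fpart q A = A ->
  m (in_t A) = tau * in_t A - (-1) ^+ q *: (in_t A * tau).
Proof.
move=> Aq; rewrite /m /moore_map !der_in_t subr0 addr0.
by rewrite (@ad_tau_part _ _ q) // part_in_t Aq.
Qed.

(** The terms in tau cancel on both generators.  On tau, xi(tau^2) is
    A tau + (-1)^p tau A, which is also (-1)^p m(A); on t the same happens with
    B in place of A. *)
Lemma commutator_in_t p A B : fpart (~~ p) A = A -> fpart (~~ p) B = B ->
  let D := der d (in_t A) (in_t B) in
  (fun f : ncps R => D (m f) - (-1) ^+ p *: m (D f)) =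
  der d (in_t (qderiv p W * B))
        (in_t (if p then 0 else (2 : R) *: (fpsX R * A))).
Proof.
move=> Ap Bp D; have dD : is_der d p D := der_in_t_is_der Ap Bp.
have dm := moore_map_is_der.
have dC := is_der_commutator dD dm; rewrite andbT in dC.
(* Only the summand of parity p of D survives, by the parity of B. *)
have DW : D (in_t W) = in_t (qderiv p W * B).
  rewrite /D /der (bigD1 p) //= (pder_in_t _ (B := B)) ?big1 ?addr0 //.
    move=> q qp; rewrite (pder_in_t _ (B := 0)) ?mulr0 ?in_t0 //.
    rewrite part_in_t oddz_gdeg // addbT -[RHS]in_t0; congr in_t.
    apply/funext => n.
    rewrite -Bp /fpart; case: eqP => // ->.
    by rewrite (inj_eq negb_inj) (negPf qp).
  by rewrite part_in_t oddz_gdeg // addbT Bp.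
have Dtau : D tau = in_t A by exact: der_tau.
have Dtee : D tee = in_t B by exact: der_tee.
rewrite (der_unique dC); congr (der d _ _).
  rewrite moore_map_tau (is_derD _ _ dD).
  rewrite (der_leibniz dD _ (part_gen R odd_d Tau)) Dtau andbT DW.
  rewrite (moore_map_in_t Ap); apply/funext => u.
  rewrite !(ncpsD, ncpsN, ncpsZ).
  by case: p {Ap Bp D dD dC DW Dtau Dtee} => /=; ring.
rewrite moore_map_tee (is_derD _ _ dD).
rewrite (der_leibniz dD _ (part_gen R odd_d Tau)).
rewrite (der_leibniz dD _ (part_gen R odd_d Tee)).
rewrite Dtau Dtee andbT (moore_map_in_t Bp).
have AX : in_t A * tee = tee * in_t A by rewrite -in_tX in_t_comm.
apply/funext => u; rewrite AX !(ncpsD, ncpsN, ncpsZ).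
case: p {Ap Bp D dD dC DW Dtau Dtee} => /=.
  by rewrite in_t0 ncps0; ring.
by rewrite in_tZ in_tM in_tX ncpsZ; ring.
Qed.

Lemma hoch_diff_is_der p D : is_der d p D ->
  hoch_diff d m D = fun f : ncps R => D (m f) - (-1) ^+ p *: m (D f).
Proof.
move=> dD; apply/funext => f; rewrite /hoch_diff (bigD1 p) //= big1 ?addr0.
  by rewrite (op_part_is_der _ dD) eqxx.
move=> q qp; rewrite (op_part_is_der _ dD) (negPf qp).
by rewrite (is_der0 moore_map_is_der) scaler0 subr0.
Qed.

(** The odd part of the derivation, given by the even parts of A and B, has zero
    differential because W is even; only the odd parts of A and B remain. *)
Lemma hoch_diff_in_t A B :
  hoch_diff d m (der d (in_t A) (in_t B)) =
  der d (in_t (fps_deriv W * fpart true B))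
        (in_t ((2 : R) *: (fpsX R * fpart true A))).
Proof.
have H p : let q := ~~ p in
    hoch_diff d m (der d (in_t (fpart q A)) (in_t (fpart q B))) =
    der d (in_t (qderiv p W * fpart q B))
        (in_t (if p then 0 else (2 : R) *: (fpsX R * fpart q A))).
  have Ap := fpart_idem (~~ p) A; have Bp := fpart_idem (~~ p) B.
  by rewrite /= (hoch_diff_is_der (der_in_t_is_der Ap Bp)) commutator_in_t.
have dsum (f g f1 g1 : ncps R) :
    der d (f + f1) (g + g1) = der d f g + der d f1 g1.
  by have := der_linear_coef d 1 f g f1 g1; rewrite !scale1r.
rewrite -{1}(fpart_sum A) -{1}(fpart_sum B) !in_tD dsum.
have hl := hoch_diff_linear d (der_linear moore_map_is_der).
have := hl 1 (der d (in_t (fpart true A)) (in_t (fpart true B)))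
  (der d (in_t (fpart false A)) (in_t (fpart false B))).
rewrite !scale1r => ->; rewrite (H false) (H true) qderiv_true // mul0r.
by rewrite -dsum in_t0 !addr0.
Qed.

End EvenW.
End Differential.

(** * Cocycles and coboundaries *)

Section Main.
Variables (R : comUnitRingType) (Rg : int -> R -> Prop) (d : int).
Hypothesis odd_d : odd `|d|%N.
Variables (A : odd_moore d Rg) (w : nat -> R).
Hypothesis moore_A : moore_m A = moore_map d (even_series w).
Implicit Types (a b f h : fps R).

Let V : fps R := fps_deriv (tilde_series w).
Let m := moore_m A.
Let two : R := 2.

Lemma even_series_even : fpart false (even_series w) = even_series w.
Proof.
by apply/funext => n; rewrite /fpart /even_series; case: odd; rewrite ?andbF.
Qed.

Lemma deriv_even_series :
  fps_deriv (even_series w) = fpsX R * stretch (two *: V).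
Proof.
apply/funext => -[|n]; rewrite fpsXM /fps_deriv /even_series /= ?mul0rn //.
rewrite negbK /stretch; case: (boolP (odd n)) => o /=; first by rewrite mul0rn.
rewrite fpsZ /V /fps_deriv /tilde_series /= /two mulr_natl -mulrnA.
by congr (_ *+ _); lia.
Qed.

(** In the coordinates t^2 f(t^2) for even and t f(t^2) for odd series, the
    differential is (a, b) |-> (2 V b, 2 a) from odd to even coefficients. *)
Lemma hoch_diff_lift a b :
  hoch_diff d m (der d (in_t a) (in_t b)) =
  der d (in_t (even_lift (two *: (V * odd_half b))))
        (in_t (even_lift (two *: odd_half a))).
Proof.
rewrite /m moore_A (hoch_diff_in_t odd_d even_series_even).
rewrite deriv_even_series !fpart_true /even_lift.
rewrite [two *: (V * _)]scalerAl stretchM; congr (der d (in_t _) (in_t _)).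
  by rewrite mulrACA !mulrA.
by rewrite stretchZ !fps_mulZr.
Qed.

Lemma der_in_t_inj a b a' b' :
  der d (in_t a) (in_t b) = der d (in_t a') (in_t b') -> a = a' /\ b = b'.
Proof.
move=> e; have := congr1 (fun D => D tau) e; have := congr1 (fun D => D tee) e.
by rewrite !der_tee !der_tau => /in_t_inj -> /in_t_inj ->.
Qed.

Lemma der0 : der d (in_t 0) (in_t 0) = 0 :> (ncps R -> ncps R).
Proof.
rewrite in_t0; have := der_linear_coef d (-1) (0 : ncps R) 0 0 0.
by rewrite scaler0 addr0 => ->; rewrite scaleN1r addNr.
Qed.

Lemma lift_cochain a b :
  der d (in_t (even_lift a)) (in_t (even_lift b)) \in cochains d.
Proof.
by apply/asboolP; exists (even_lift a), (even_lift b); rewrite !even_liftE.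
Qed.

Lemma lift_cocycle a b :
  der d (in_t (even_lift a)) (in_t (even_lift b)) \in cocycles A.
Proof.
rewrite /cocycles unfold_in lift_cochain; apply/asboolP.
by rewrite hoch_diff_lift !odd_half_lift mulr0 !scaler0 even_lift0 der0.
Qed.

Hypothesis unit2 : (2%:R : R) \is a GRing.unit.
Hypothesis V_reg : forall f, V * f = 0 -> f = 0.

(** For a cocycle the odd parts of both coefficients vanish, since the
    differential is injective on them: 2 is a unit and V is regular. *)
Lemma cocycle_lift D : D \in cocycles A ->
  exists a b, D = der d (in_t (even_lift a)) (in_t (even_lift b)).
Proof.
have two_reg f : two *: f = 0 -> f = 0.
  by move=> f0; rewrite -[f]scale1r -(mulVr unit2) -scalerA f0 scaler0.
rewrite /cocycles unfold_in => /andP[/asboolP[a [b [a0 b0 ->]]] /asboolP].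
rewrite hoch_diff_lift -der0 => /der_in_t_inj[].
move=> /even_lift_eq0/two_reg/V_reg bo /even_lift_eq0/two_reg ao.
by exists (even_half a), (even_half b); rewrite -!even_lift_half.
Qed.

Definition coef_t (f : ncps R) : fps R := fun n => f (nseq n Tee).

Lemma coef_t_in_t f : coef_t (in_t f) = f.
Proof.
by apply/funext => n; rewrite /coef_t /in_t all_nseq orbT size_nseq.
Qed.

(** The invariant of a cohomology class: the series a(t) such that the cocycle
    maps tau to t^2 a(t^2).  It is read off the value at tau so that it is
    visibly linear. *)
Definition class_series (z : cocycle A) : fps R :=
  even_half (coef_t (val z tau)).

Lemma class_series_linear : linear class_series.
Proof. by move=> r x y; rewrite /class_series linearP. Qed.
HB.instance Definition _ :=
  GRing.isLinear.Build R (cocycle A) (fps R) *:%R class_series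
    class_series_linear.

Lemma class_seriesE z a b :
  val z = der d (in_t a) (in_t b) -> class_series z = even_half a.
Proof. by rewrite /class_series => ->; rewrite der_tau coef_t_in_t. Qed.

Lemma class_series_surj a : exists z, class_series z = a.
Proof.
exists (exist (fun D => D \in cocycles A) _ (lift_cocycle a 0)).
by rewrite (@class_seriesE _ (even_lift a) (even_lift 0)) ?even_half_lift.
Qed.

(** If tau |-> t^2 V(t^2) h(t^2) and t |-> t^2 b(t^2), the cocycle is the
    differential of (1/2) (t b(t^2) d/dtau + t h(t^2) d/dt). *)
Lemma coboundary_class_series z :
  z \in coboundaries (A := A) <-> class_series z \in principal_ideal V.
Proof.
split=> [/asboolP[D /asboolP[a [b [a0 b0 ->]]]]|/asboolP[h zh]].
  rewrite hoch_diff_lift => /class_seriesE ->; rewrite even_half_lift.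
  by apply/asboolP; exists (two *: odd_half b); rewrite fps_mulZr.
have [a [b zE]] := cocycle_lift (valP z); apply/asboolP.
pose half_lift f := fpsX R * stretch (two^-1 *: f).
exists (der d (in_t (half_lift b)) (in_t (half_lift h))).
  apply/asboolP; exists (half_lift b), (half_lift h).
  by rewrite /half_lift !fpsXM.
rewrite zE hoch_diff_lift !odd_half_Xstretch fps_mulZr !scalerA divrr //.
by rewrite !scale1r -zh (class_seriesE zE) even_half_lift.
Qed.

End Main.

Theorem proposition4p3 (R : comUnitRingType) (Rg : int -> R -> Prop)
    (hR : evenly_graded Rg) (h2 : (2%:R : R) \is a GRing.unit)
    (d : int) (hd : odd `|d|%N)
    (A : odd_moore d Rg) (w : nat -> R)
    (hA : moore_m A = (fun f => ad_tau d f - der d (tau ^+ 2) 0 f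
                                + der d (in_t (even_series w)) 0 f))
    (k : nat) (hk : (0 < k)%N) (wk_neq0 : w k != 0)
    (wk_first : forall i, (0 < i < k)%N -> w i = 0)
    (wk_reg : GRing.lreg (w k))
    (R_torsion : forall r : R, r *+ k = 0 -> r = 0) :
  exists phi : {linear HH A ->
      lmod_quot (principal_ideal_closed (fps_deriv (tilde_series w)))},
    bijective phi.
Proof.
(* The lowest nonzero coefficient of the derivative is k w_k, in degree k - 1. *)
have V_reg f : fps_deriv (tilde_series w) * f = 0 -> f = 0.
  apply: (@fps_reg _ _ _ k.-1) => [i ik|r].
    by rewrite /fps_deriv /tilde_series wk_first ?mul0rn //; lia.
  rewrite /fps_deriv /tilde_series prednK // hk mulrnAl => /R_torsion wr0.
  by apply: wk_reg; rewrite wr0 mulr0.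
have cob := coboundary_class_series hd hA h2 V_reg.
have sur := class_series_surj hd hA.
exact: (lmod_quot_iso (coboundaries_closed A) (principal_ideal_closed _)
  cob sur).
Qed.
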